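(* Let $G$ be a finite $5$-regular graph (multiple edges allowed) on $2n$ vertices which has the triangle property. Then $G$ contains at least $2n$ triangles, and $G$ has at least $n$ edges each of which lies in at least two triangles.
   Context: Graphs may have multiple edges. A triangle is a set of three distinct vertices with a choice of one edge joining each pair of them (so multiple edges give several triangles on the same vertex set; loops are in no triangle). A graph has the triangle property if every edge lies in at least one triangle. *)

(* Defs.v *)
From mathcomp Require Import all_boot.

Set Implicit Arguments.
Unset Strict Implicit.
Unset Printing Implicit Defensive.

(* [ends e] has two elements for an ordinary edge and one for a loop;
   parallel edges are distinct elements of [edge] with equal [ends]. *)
Record mgraph := MGraph {
  vert : finType;
  edge : finType;
  ends : edge -> {set vert};
  ends_card : forall e, 0 < #|ends e| <= 2
}.

Section MGraphTheory.
Variable G : mgraph.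
Implicit Types (v : vert G) (e : edge G).

Definition is_loop e := #|ends e| == 1.

(* A loop contributes 2 to the degree of its vertex. *)
Definition degree v : nat :=
  \sum_(e : edge G | v \in ends e) (if is_loop e then 2 else 1).

Definition regular (k : nat) : Prop := forall v, degree v = k.

Definition pairs_of (S : {set vert G}) : {set {set vert G}} :=
  [set P : {set vert G} | (P \subset S) && (#|P| == 2)].

(* A triangle is given by its vertex set [t.1] and the set [t.2] of the chosen
   edges, one for each pair of vertices. *)
Definition is_triangle (t : {set vert G} * {set edge G}) : bool :=
  [&& #|t.1| == 3,
      [forall e in t.2, ends e \in pairs_of t.1]
    & [forall P in pairs_of t.1, #|[set e in t.2 | ends e == P]| == 1]].

Definition triangles : {set {set vert G} * {set edge G}} :=
  [set t | is_triangle t].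

Definition triangles_at e : {set {set vert G} * {set edge G}} :=
  [set t in triangles | e \in t.2].

Definition triangle_property : Prop := forall e, 0 < #|triangles_at e|.

End MGraphTheory.

(* Main.v *)
Require Import Defs.
From mathcomp Require Import all_boot.

(** A triangle through a vertex [v] uses exactly two of the five edges at [v].
    Hence the numbers of triangles on these five edges, each at least 1, sum to
    an even number, twice the number of triangles through [v].  So this sum is
    at least 6: at least three triangles pass through [v], and some edge at [v]
    lies in two of them.  Both bounds follow by double counting, since a
    triangle has three vertices and an edge has two ends. *)

(** Sending [x] to [[set v; x]] is a bijection from [S :\ v] onto these pairs. *)
Lemma card_pairs_of_at (G : mgraph) (S : {set vert G}) (v : vert G) :
  v \in S -> #|[set P in pairs_of S | v \in P]| = #|S|.-1.
Proof.
move=> vS; rewrite (cardsD1 v S) vS add1n /=.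
have injv : {in S :\ v &, injective (fun x => [set v; x])}.
  move=> x y; rewrite !inE => /andP[xv _] _ /setP/(_ x).
  by rewrite !inE eqxx orbT (negPf xv) => /esym/eqP.
rewrite -(card_in_imset injv); apply: eq_card => P.
apply/idP/imsetP => [|[x + ->]]; rewrite !inE.
  case/andP=> /andP[sPS cP] vP.
  have /cards1P[x Px] : #|P :\ v| == 1 by rewrite (cardsD1 v P) vP eqSS in cP.
  have : x \in P :\ v by rewrite Px set11.
  rewrite !inE => /andP[xv xP]; exists x; first by rewrite !inE xv (subsetP sPS).
  by rewrite -(setD1K vP) Px.
case/andP=> xv xS; rewrite cards2 [v == x]eq_sym xv !eqxx andbT.
by rewrite subUset !sub1set vS xS.
Qed.

(** Sort the chosen edges at [v] by their ends: each of the two pairs of [t.1] through [v] carries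
    exactly one. If [v] is outside [t.1], no chosen edge reaches it. *)
Lemma sum_triangle_edges_at (G : mgraph) (t : {set vert G} * {set edge G})
    (v : vert G) :
  is_triangle t ->
  \sum_(e in t.2 | v \in ends e) 1 = (v \in t.1) * 2.
Proof.
case/and3P=> /eqP t3 /forall_inP tE /forall_inP tP.
have [vt|vt] := boolP (v \in t.1); last first.
  rewrite big1 // => e /andP[/tE]; rewrite inE => /andP[/subsetP sub _] /sub.
  by rewrite (negPf vt).
have <- : #|[set P in pairs_of t.1 | v \in P]| = 2.
  by rewrite card_pairs_of_at // t3.
rewrite mul1n -[RHS]sum1_card.
rewrite (partition_big (@ends G) [in [set P in pairs_of t.1 | v \in P]]) /=; last first.
  by move=> e /andP[et ve]; rewrite inE tE.
apply: eq_bigr => P; rewrite inE => /andP[Pt vP].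
rewrite -[RHS](eqP (tP _ Pt)) -sum1_card; apply: eq_bigl => e; rewrite inE.
by case: eqP => [->|]; rewrite ?vP ?andbT ?andbF.
Qed.

(** Count in two ways the pairs of an edge at [v] and a triangle using it. The factor 2 gives the
    parity on which both bounds rest. *)
Lemma sum_triangles_at (G : mgraph) (v : vert G) :
  \sum_(e | v \in ends e) #|triangles_at e| =
    #|[set t in triangles G | v \in t.1]| * 2.
Proof.
under eq_bigr => e _ do rewrite -sum1_card.
rewrite (exchange_big_dep [in triangles G]) /=; last first.
  by move=> e t _; rewrite inE => /andP[].
rewrite -sum1_card big_distrl /= [RHS]big_mkcond [LHS]big_mkcond /=.
apply: eq_bigr => t _; rewrite !inE; case: ifP => //= tT.
transitivity ((v \in t.1) * 2); last by case: ifP.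
rewrite -sum_triangle_edges_at //; apply: eq_bigl => e.
by rewrite !inE tT andbC.
Qed.

Lemma triangle_property_card_ends (G : mgraph) (e : edge G) :
  triangle_property G -> #|ends e| = 2.
Proof.
move=> /(_ e)/card_gt0P[t]; rewrite !inE => /andP[/and3P[_ /forall_inP tE _]].
by move/tE; rewrite inE => /andP[_ /eqP].
Qed.

(** An edge in a triangle is no loop, so the weight 2 in [degree] never occurs. *)
Lemma triangle_property_degree (G : mgraph) (v : vert G) :
  triangle_property G -> degree v = \sum_(e : edge G | v \in ends e) 1.
Proof.
by move=> GT; apply: eq_bigr => e _; rewrite /is_loop triangle_property_card_ends.
Qed.

Lemma card_triangles_vertex (G : mgraph) (v : vert G) :
  degree v = 5 -> triangle_property G ->
  2 < #|[set t in triangles G | v \in t.1]|.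
Proof.
move=> dv GT; have : degree v <= \sum_(e | v \in ends e) #|triangles_at e|.
  by rewrite triangle_property_degree //; apply: leq_sum.
(* Twice the number of triangles at [v] is at least 5, which excludes 0, 1 and 2. *)
by rewrite dv sum_triangles_at; case: #|_| => [|[|[|k]]].
Qed.

Lemma exists_edge_two_triangles (G : mgraph) (v : vert G) :
  odd (degree v) -> triangle_property G ->
  exists2 e : edge G, v \in ends e & 2 <= #|triangles_at e|.
Proof.
move=> dv GT.
have [/existsP[e /andP[]]|/existsPn no] :=
  boolP [exists e : edge G, (v \in ends e) && (2 <= #|triangles_at e|)].
  by exists e.
(* Otherwise each edge at [v] lies in exactly one triangle, so the odd degree equals the even sum of
   [sum_triangles_at]. *)
move: dv; rewrite triangle_property_degree //.
rewrite (eq_bigr (fun e => #|triangles_at e|)) => [|e ve].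
  by rewrite sum_triangles_at oddM andbF.
by move: (no e) (GT e); rewrite ve /=; case: #|_| => [|[]].
Qed.

Theorem theorem2 (G : mgraph) (n : nat) (card_vert : #|vert G| = 2 * n)
    (G_regular : regular G 5) (G_triangle : triangle_property G) :
  2 * n <= #|triangles G| /\
  n <= #|[set e : edge G | 2 <= #|triangles_at e|]|.
Proof.
split.
  (* Count incidences of vertices and triangles: three per triangle, at least three per vertex. *)
  rewrite -(leq_pmul2r (isT : 0 < 3)) -card_vert -!sum1_card !big_distrl /=.
  have -> : \sum_(t in triangles G) 1 * 3 =
            \sum_v #|[set t in triangles G | v \in t.1]|.
    under [RHS]eq_bigr => v _ do rewrite -sum1_card.
    rewrite (exchange_big_dep [in triangles G]) /=; last first.
      by move=> v t _; rewrite inE => /andP[].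
    apply: eq_bigr => t tT; move: (tT); rewrite inE => /and3P[/eqP <- _ _].
    by rewrite mul1n -sum1_card; apply: eq_bigl => v; rewrite inE tT.
  by apply: leq_sum => v _; apply: card_triangles_vertex.
(* Count incidences of vertices with edges in at least two triangles: two per edge, at least one per
   vertex since 5 is odd. *)
rewrite -(leq_pmul2l (isT : 0 < 2)) -card_vert mulnC -sum_nat_const.
set H := [set e | _].
have -> : \sum_(e in H) 2 = \sum_v \sum_(e in H | v \in ends e) 1.
  rewrite (exchange_big_dep [in H]) /=; last by move=> v e _ /andP[].
  apply: eq_bigr => e eH; rewrite -(triangle_property_card_ends _ e G_triangle).
  by rewrite -sum1_card; apply: eq_bigl => v; rewrite eH.
rewrite -sum1_card; apply: leq_sum => v _.
have [|e ve eH] := exists_edge_two_triangles _ v _ G_triangle.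
  by rewrite G_regular.
by rewrite (bigD1 e) //= inE eH.
Qed.
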